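(* Let $S$ be a reduced $E$-Fountain semigroup which satisfies the congruence condition and such that the relation $\trianglelefteq_l$ on $S$ is principally finite. Let $\Bbbk$ be a commutative unital ring, let $\mathcal{C}$ be the category associated with $S$, and let $\varphi:\Bbbk S\to\Bbbk\mathcal{C}$ be the $\Bbbk$-module homomorphism defined on basis elements $a\in S$ by $$\varphi(a)=\sum_{c\trianglelefteq_l a}C(c).$$ Then $\varphi$ is a homomorphism of $\Bbbk$-algebras if and only if the generalized right ample identity holds in $S$.
   Context: Let $S$ be a semigroup and $E\subseteq S$ a subset of idempotents, with the natural partial order $e\le f\iff ef=fe=e$. For $a\in S$ put $a_E=\{e\in E\mid ae=a\}$ and ${}_E a=\{e\in E\mid ea=a\}$. Define equivalence relations on $S$ by $a\,\widetilde{\mathcal{L}}_E\,b\iff a_E=b_E$ and $a\,\widetilde{\mathcal{R}}_E\,b\iff {}_Ea={}_Eb$. $S$ is $E$-Fountain if every $\widetilde{\mathcal{L}}_E$-class and every $\widetilde{\mathcal{R}}_E$-class contains an element of $E$; it is reduced if moreover $ef=e\iff fe=e$ for all $e,f\in E$. In a reduced $E$-Fountain semigroup, for every $a\in S$ the sets $a_E$ and ${}_Ea$ have minimum elements with respect to $\le$, denoted $a^\ast$ and $a^+$ respectively. Congruence condition: $\widetilde{\mathcal{L}}_E$ is a right congruence and $\widetilde{\mathcal{R}}_E$ is a left congruence (equivalently, $(ab)^\ast=(a^\ast b)^\ast$ and $(ab)^+=(ab^+)^+$ for all $a,b\in S$). Relation $\trianglelefteq_l$: $a\trianglelefteq_l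 b\iff a=be$ for some $e\in E$. A relation $R$ on a set $X$ is principally finite if $\{x'\in X\mid x'Rx\}$ is finite for every $x\in X$. Associated category $\mathcal{C}$ (when $S$ satisfies the congruence condition): objects are the elements of $E$; morphisms are $C(a)$, in bijection with $a\in S$, where $C(a)$ has domain $a^\ast$ and range $a^+$; composition is from right to left: if $b^\ast=a^+$ then $C(b)\cdot C(a)=C(ba)$. $\Bbbk S$ is the semigroup algebra. The category algebra $\Bbbk\mathcal{C}$ is the free $\Bbbk$-module on the morphisms of $\mathcal{C}$, with multiplication the linear extension of $m'\cdot m=m'm$ if the composition is defined and $0$ otherwise. Generalized right ample identity (condition): $\left(e\left(a(eaf)^\ast\right)^+\right)^\ast=\left(a(eaf)^\ast\right)^+$ for every $a\in S$ and $e,f\in E$. *)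

(* Defs.v *)
From HB Require Import structures.
From mathcomp Require Import all_boot all_algebra.
From mathcomp Require Import finmap.
From mathcomp Require Import boolp classical_sets cardinality fsbigop.
From mathcomp.multinomials Require Import monalg.
Set Implicit Arguments. Unset Strict Implicit. Unset Printing Implicit Defensive.
Import GRing.Theory.
Local Open Scope classical_set_scope.
Local Open Scope ring_scope.

Section Relations.
Variables (S : semigroupType) (E : set S).
Implicit Types a b c e f m : S.

Definition nat_le e f := (e * f = e /\ f * e = e)%g.

Definition right_ids a : set S := [set e | E e /\ (a * e = a)%g].
Definition left_ids a : set S := [set e | E e /\ (e * a = a)%g].

Definition eqL a b := right_ids a = right_ids b.
Definition eqR a b := left_ids a = left_ids b.

Record reduced_EFountain : Prop := ReducedEFountain {
  E_idempotent : forall e, E e -> (e * e = e)%g;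
  eqL_class_meets_E : forall a, exists2 e, E e & eqL a e;
  eqR_class_meets_E : forall a, exists2 e, E e & eqR a e;
  E_reduced : forall e f, E e -> E f -> (e * f = e <-> f * e = e)%g
}.

Record congruence_condition : Prop := CongruenceCondition {
  eqL_right_congruence : forall a b c, eqL a b -> eqL (a * c)%g (b * c)%g;
  eqR_left_congruence : forall a b c, eqR a b -> eqR (c * a)%g (c * b)%g
}.

Definition is_minimum (A : set S) m := A m /\ forall f, A f -> nat_le m f.

(* The default value [a] is never used on a reduced E-Fountain semigroup:
   see [starP] and [plusP]. *)
Definition star a := xget a (is_minimum (right_ids a)).
Definition plus a := xget a (is_minimum (left_ids a)).

Definition le_l a b := exists2 e, E e & (a = b * e)%g.

Definition generalized_right_ample := forall a e f, E e -> E f ->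
  let x := plus (a * star (e * a * f))%g in star (e * x)%g = x.

Hypothesis hE : reduced_EFountain.

Lemma is_minimum_unique A m m' : is_minimum A m -> is_minimum A m' -> m = m'.
Proof.
by move=> [Am lem] [Am' lem']; have [<- _] := lem _ Am'; have [_ ->] := lem' _ Am.
Qed.

Lemma starP a : is_minimum (right_ids a) (star a).
Proof.
apply: xgetPex; have [e Ee ae] := eqL_class_meets_E hE a; exists e.
rewrite ae; split; first by split=> //; exact: E_idempotent.
by move=> f [Ef ef]; split=> //; apply/E_reduced.
Qed.

Lemma plusP a : is_minimum (left_ids a) (plus a).
Proof.
apply: xgetPex; have [e Ee ae] := eqR_class_meets_E hE a; exists e.
rewrite ae; split; first by split=> //; exact: E_idempotent.
by move=> f [Ef fe]; split=> //; apply/E_reduced.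
Qed.

Lemma star_in a : E (star a). Proof. by have [[]] := starP a. Qed.
Lemma plus_in a : E (plus a). Proof. by have [[]] := plusP a. Qed.
Lemma mul_star a : (a * star a = a)%g. Proof. by have [[]] := starP a. Qed.
Lemma mul_plus a : (plus a * a = a)%g. Proof. by have [[]] := plusP a. Qed.

Lemma eqL_eq_star a b : eqL a b -> star a = star b.
Proof.
by move=> ab; apply: is_minimum_unique (starP b); rewrite -ab; exact: starP.
Qed.

Lemma eqR_eq_plus a b : eqR a b -> plus a = plus b.
Proof.
by move=> ab; apply: is_minimum_unique (plusP b); rewrite -ab; exact: plusP.
Qed.

Lemma eqL_star a : eqL a (star a).
Proof.
apply/seteqP; split=> f [Ef af]; split=> //.
  by have [] := (starP a).2 f (conj Ef af).
by rewrite -{1}(mul_star a) -mulgA af mul_star.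
Qed.

Lemma eqR_plus a : eqR a (plus a).
Proof.
apply/seteqP; split=> f [Ef fa]; split=> //.
  by have [] := (plusP a).2 f (conj Ef fa).
by rewrite -{1}(mul_plus a) mulgA fa mul_plus.
Qed.

Lemma star_id e : E e -> star e = e.
Proof.
move=> Ee; apply: is_minimum_unique (starP e) _; split.
  by split=> //; exact: E_idempotent.
by move=> f [Ef ef]; split=> //; apply/E_reduced.
Qed.

Lemma plus_id e : E e -> plus e = e.
Proof.
move=> Ee; apply: is_minimum_unique (plusP e) _; split.
  by split=> //; exact: E_idempotent.
by move=> f [Ef ef]; split=> //; apply/E_reduced.
Qed.

Hypothesis hC : congruence_condition.

Lemma star_mul a b : star (a * b)%g = star (star a * b)%g.
Proof. apply/eqL_eq_star/eqL_right_congruence => //; exact: eqL_star. Qed.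

Lemma plus_mul a b : plus (a * b)%g = plus (a * plus b)%g.
Proof. apply/eqR_eq_plus/eqR_left_congruence => //; exact: eqR_plus. Qed.

End Relations.

Definition principally_finite (X : Type) (r : X -> X -> Prop) :=
  forall x, finite_set [set x' | r x' x].

(* Small categories, with composition written from right to left:
   [comp g f] is defined when the domain of [g] is the range of [f]. *)
Record category := Category {
  obj : choiceType;
  mor : choiceType;
  dom : mor -> obj;
  ran : mor -> obj;
  idm : obj -> mor;
  comp : forall g f : mor, dom g = ran f -> mor;
  dom_idm : forall x, dom (idm x) = x;
  ran_idm : forall x, ran (idm x) = x;
  dom_comp : forall g f (gf : dom g = ran f), dom (comp gf) = dom f;
  ran_comp : forall g f (gf : dom g = ran f), ran (comp gf) = ran g;
  comp_idl : forall x f (xf : dom (idm x) = ran f), comp xf = f;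
  comp_idr : forall x f (fx : dom f = ran (idm x)), comp fx = f;
  compA : forall h g f (hg : dom h = ran g) (gf : dom g = ran f)
    (h_gf : dom h = ran (comp gf)) (hg_f : dom (comp hg) = ran f),
    comp h_gf = comp hg_f
}.

(* A copy of S: [C a] is the morphism attached to [a]. *)
Record assoc_mor (S : Type) := C { assoc_elt : S }.
HB.instance Definition _ (S : Type) := [isNew for @assoc_elt S].
HB.instance Definition _ (S : choiceType) := [Choice of assoc_mor S by <:].

Section AssociatedCategory.
Variables (S : semigroupType) (E : set S).
Hypotheses (hE : reduced_EFountain E) (hC : congruence_condition E).

Definition assoc_dom (c : assoc_mor S) : set_type E :=
  exist _ (star E (assoc_elt c)) (mem_set (star_in hE (assoc_elt c))).
Definition assoc_ran (c : assoc_mor S) : set_type E :=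
  exist _ (plus E (assoc_elt c)) (mem_set (plus_in hE (assoc_elt c))).
Definition assoc_idm (e : set_type E) : assoc_mor S := C (val e).
Definition assoc_comp (d c : assoc_mor S) (_ : assoc_dom d = assoc_ran c) :
  assoc_mor S := C (assoc_elt d * assoc_elt c)%g.

Lemma assoc_composableP d c : assoc_dom d = assoc_ran c <->
  star E (assoc_elt d) = plus E (assoc_elt c).
Proof. by split=> [/(congr1 val)//|dc]; apply: val_inj. Qed.

Fact assoc_dom_idm e : assoc_dom (assoc_idm e) = e.
Proof. by apply/val_inj/(star_id hE)/set_mem/(valP e). Qed.

Fact assoc_ran_idm e : assoc_ran (assoc_idm e) = e.
Proof. by apply/val_inj/(plus_id hE)/set_mem/(valP e). Qed.

Fact assoc_dom_comp d c (dc : assoc_dom d = assoc_ran c) :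
  assoc_dom (assoc_comp dc) = assoc_dom c.
Proof.
apply: val_inj => /=; rewrite (star_mul hE hC).
by rewrite (assoc_composableP d c).1 // mul_plus.
Qed.

Fact assoc_ran_comp d c (dc : assoc_dom d = assoc_ran c) :
  assoc_ran (assoc_comp dc) = assoc_ran d.
Proof.
apply: val_inj => /=; rewrite (plus_mul hE hC).
by rewrite -(assoc_composableP d c).1 // mul_star.
Qed.

Fact assoc_comp_idl e c (ec : assoc_dom (assoc_idm e) = assoc_ran c) :
  assoc_comp ec = c.
Proof.
case: c ec => c ec; congr C => /=.
by move: ec; rewrite assoc_dom_idm => ->; rewrite /= mul_plus.
Qed.

Fact assoc_comp_idr e c (ce : assoc_dom c = assoc_ran (assoc_idm e)) :
  assoc_comp ce = c.
Proof.
case: c ce => c ce; congr C => /=.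
by move: ce; rewrite assoc_ran_idm => <-; rewrite /= mul_star.
Qed.

Fact assoc_compA b c d (bc : assoc_dom b = assoc_ran c)
    (cd : assoc_dom c = assoc_ran d) (b_cd : assoc_dom b = assoc_ran (assoc_comp cd))
    (bc_d : assoc_dom (assoc_comp bc) = assoc_ran d) :
  assoc_comp b_cd = assoc_comp bc_d.
Proof. by congr C; rewrite /= mulgA. Qed.

Definition associated_category : category :=
  Category assoc_dom_idm assoc_ran_idm assoc_dom_comp assoc_ran_comp
    assoc_comp_idl assoc_comp_idr assoc_compA.

End AssociatedCategory.

(* Associative algebras, not necessarily unital: neither the algebra of a
   semigroup nor that of a category with infinitely many objects need have a
   unit. *)
Record assoc_algebra (k : comNzRingType) := AssocAlgebra {
  alg_mod :> lmodType k;
  alg_mul : alg_mod -> alg_mod -> alg_mod;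
  alg_mul_linearl : forall y, linear (alg_mul^~ y);
  alg_mul_linearr : forall x, linear (alg_mul x);
  alg_mulA : associative alg_mul
}.

Definition algebra_hom (k : comNzRingType) (A B : assoc_algebra k) (f : A -> B) :=
  linear f /\ forall x y, f (alg_mul x y) = alg_mul (f x) (f y).

Section LinearExtension.
Variables (k : comNzRingType) (K : choiceType).

Definition lin_ext (M : lmodType k) (p : K -> M) (x : {malg k[K]}) : M :=
  \sum_(a <- msupp x) x@_a *: p a.

Lemma lin_extEw (M : lmodType k) (p : K -> M) (x : {malg k[K]}) (D : {fset K}) :
  (msupp x `<=` D)%fset -> lin_ext p x = \sum_(a <- D) x@_a *: p a.
Proof.
move=> sD; rewrite /lin_ext; apply: big_fset_incl => // a _ ax.
by rewrite mcoeff_outdom // scale0r.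
Qed.

Lemma lin_ext_basis (M : lmodType k) (p : K -> M) a : lin_ext p << a >> = p a.
Proof. by rewrite /lin_ext msuppU oner_eq0 big_seq_fset1 mcoeffUU scale1r. Qed.

Lemma lin_ext_linear (M : lmodType k) (p : K -> M) : linear (lin_ext p).
Proof.
move=> c x y; pose D := (msupp x `|` msupp y `|` msupp (c *: x + y))%fset.
have sx : (msupp x `<=` D)%fset by rewrite /D -fsetUA fsubsetUl.
have sy : (msupp y `<=` D)%fset by rewrite /D fsetUAC fsubsetUr.
rewrite (lin_extEw p sx) (lin_extEw p sy) (lin_extEw p (fsubsetUr _ _ : _ `<=` D)%fset).
rewrite scaler_sumr -big_split /=; apply: eq_bigr => a _.
by rewrite mcoeffD mcoeffZ scalerDl scalerA.
Qed.

Lemma eq_linear_basis (M : lmodType k) (f g : {malg k[K]} -> M) :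
  linear f -> linear g -> (forall a, f << a >> = g << a >>) -> f =1 g.
Proof.
move=> lf lg fg.
have f0 : f 0 = 0 by have := lf (-1) 0 0; rewrite scaler0 addr0 scaleN1r addNr.
have g0 : g 0 = 0 by have := lg (-1) 0 0; rewrite scaler0 addr0 scaleN1r addNr.
move=> x; rewrite (monalgE x); elim/big_ind: _ => [|u v fu fv|a _].
- by rewrite f0 g0.
- by rewrite -(scale1r u) lf lg fu fv.
have -> : << x@_a *g a >> = x@_a *: << a >> :> {malg k[K]}.
  by apply/malgP => b; rewrite mcoeffZ !mcoeffU mulr_natr.
by rewrite -[_ *: _]addr0 lf lg f0 g0 fg.
Qed.

(* The product on the free module {malg k[K]} which is the bilinear extension
   of the table [t] of products of basis elements. *)
Variable t : K -> K -> {malg k[K]}.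

Definition bilin_ext (x y : {malg k[K]}) : {malg k[K]} :=
  lin_ext (fun a => lin_ext (t a) y) x.

Lemma bilin_ext_basis a b : bilin_ext << a >> << b >> = t a b.
Proof. by rewrite /bilin_ext !lin_ext_basis. Qed.

Lemma bilin_ext_linearl y : linear (bilin_ext^~ y).
Proof. exact: lin_ext_linear. Qed.

Lemma bilin_ext_linearr x : linear (bilin_ext x).
Proof.
move=> c y z; rewrite /bilin_ext /lin_ext scaler_sumr -big_split /=.
apply: eq_bigr => a _; rewrite -!/(lin_ext _ _) lin_ext_linear.
by rewrite scalerDr !scalerA mulrC.
Qed.

Hypothesis tA : forall a b c, bilin_ext << a >> (t b c) = bilin_ext (t a b) << c >>.

Lemma bilin_extA : associative bilin_ext.
Proof.
move=> x y z.
apply: (eq_linear_basis (f := fun x => bilin_ext x (bilin_ext y z))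
  (g := fun x => bilin_ext (bilin_ext x y) z)) => {x} [||a].
- exact: bilin_ext_linearl.
- by move=> c u v; rewrite !bilin_ext_linearl.
apply: (eq_linear_basis (f := fun y => bilin_ext << a >> (bilin_ext y z))
  (g := fun y => bilin_ext (bilin_ext << a >> y) z)) => {y} [||b].
- by move=> c u v; rewrite bilin_ext_linearl bilin_ext_linearr.
- by move=> c u v; rewrite bilin_ext_linearr bilin_ext_linearl.
apply: (eq_linear_basis (f := fun z => bilin_ext << a >> (bilin_ext << b >> z))
  (g := bilin_ext (bilin_ext << a >> << b >>))) => {z} [||c].
- by move=> c u v; rewrite !bilin_ext_linearr.
- exact: bilin_ext_linearr.
by rewrite !bilin_ext_basis tA.
Qed.

Definition free_algebra : assoc_algebra k :=
  AssocAlgebra bilin_ext_linearl bilin_ext_linearr bilin_extA.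

End LinearExtension.

Section Algebras.
Variable k : comNzRingType.

Definition semigroup_table (S : semigroupType) (a b : S) : {malg k[S]} :=
  << (a * b)%g >>.

Fact semigroup_tableA (S : semigroupType) (a b c : S) :
  bilin_ext (@semigroup_table S) << a >> (semigroup_table b c) =
  bilin_ext (@semigroup_table S) (semigroup_table a b) << c >>.
Proof. by rewrite !bilin_ext_basis /semigroup_table mulgA. Qed.

Definition semigroup_algebra (S : semigroupType) : assoc_algebra k :=
  free_algebra (@semigroup_tableA S).

Definition category_table (X : category) (g f : mor X) : {malg k[mor X]} :=
  if dom g =P ran f is ReflectT gf then << comp gf >> else 0.

Lemma category_tableE (X : category) (g f : mor X) (gf : dom g = ran f) :
  category_table g f = << comp gf >>.
Proof.
rewrite /category_table; case: eqP => // gf'.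
by rewrite (eq_irrelevance gf' gf).
Qed.

Lemma category_table0 (X : category) (g f : mor X) :
  dom g <> ran f -> category_table g f = 0.
Proof. by rewrite /category_table; case: eqP. Qed.

Fact category_tableA (X : category) (h g f : mor X) :
  bilin_ext (@category_table X) << h >> (category_table g f) =
  bilin_ext (@category_table X) (category_table h g) << f >>.
Proof.
have r0 x : bilin_ext (@category_table X) x 0 = 0.
  by have := bilin_ext_linearr (@category_table X) x (-1) 0 0;
     rewrite scaler0 addr0 scaleN1r addNr.
have l0 x : bilin_ext (@category_table X) 0 x = 0.
  by have := bilin_ext_linearl (@category_table X) x (-1) 0 0;
     rewrite scaler0 addr0 scaleN1r addNr.
have [gf|gf] := pselect (dom g = ran f); have [hg|hg] := pselect (dom h = ran g).
- have h_gf : dom h = ran (comp gf) by rewrite ran_comp.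
  have hg_f : dom (comp hg) = ran f by rewrite dom_comp.
  rewrite (category_tableE gf) (category_tableE hg) !bilin_ext_basis.
  by rewrite (category_tableE h_gf) (category_tableE hg_f) (compA h_gf hg_f).
- rewrite (category_tableE gf) (category_table0 hg) bilin_ext_basis l0.
  by rewrite category_table0 // ran_comp.
- rewrite (category_table0 gf) (category_tableE hg) bilin_ext_basis r0.
  by rewrite category_table0 // dom_comp.
by rewrite !category_table0 // r0 l0.
Qed.

Definition category_algebra (X : category) : assoc_algebra k :=
  free_algebra (@category_tableA X).

Variables (S : semigroupType) (E : set S).
Hypotheses (hE : reduced_EFountain E) (hC : congruence_condition E).

(* [\sum_(c \in A)] is a genuine finite sum as soon as A is finite; below A is
   the set of elements under [a], finite when [le_l E] is principally finite. *)
Definition phi :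
    semigroup_algebra S -> category_algebra (associated_category hE hC) :=
  lin_ext (fun a =>
    \sum_(c \in [set c | le_l E c a]) (<< C c >> : {malg k[assoc_mor S]})).

End Algebras.
Arguments semigroup_algebra k S : clear implicits.
Arguments category_algebra k X : clear implicits.
Arguments phi k [S E] hE hC.

(* Main.v *)
Require Import Defs.
From mathcomp Require Import all_boot all_algebra boolp classical_sets.
From mathcomp Require Import finmap cardinality fsbigop.
From mathcomp.multinomials Require Import monalg.

(** Both sides of [phi (a b) = phi a phi b] are sums of basis elements, and the
    equivalence comes from comparing them coefficient by coefficient.

    The coefficient of [C x] on the left is 1 or 0 according to whether [x] lies
    below [a * b].  On the right it counts the factorizations [x = c * d] with
    [c] below [a], [d] below [b] and [star c = plus d].  There is at most one:
    the congruence condition gives [star x = star d], so [d = b * star x]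
    because an element below [b] is recovered from its star, and likewise
    [c = a * star c = a * plus d] ([factorization_unique]).  Conversely this pair
    has product [x] as soon as [x] lies below [a * b], whether or not it is
    composable.  Hence [phi] is multiplicative exactly when, for all [a], [b] and
    all [x] below [a * b], the pair is composable, that is
    [star (a * plus (b * star x)) = plus (b * star x)] ([phi_mul_basisP]).

    Writing [x = a * b * f], this is the generalized right ample identity with an
    arbitrary element [a] in place of the idempotent [e].  As stars of products
    see their left factor only through its star, nothing is lost by replacing
    [a] with [star a], so it is equivalent to that identity
    ([generalized_right_ampleP]). *)

Set Implicit Arguments. Unset Strict Implicit. Unset Printing Implicit Defensive.
Import GRing.Theory.
Local Open Scope classical_set_scope.
Local Open Scope ring_scope.

Section Factorization.
Variables (S : semigroupType) (E : set S).
Hypotheses (hE : reduced_EFountain E) (hC : congruence_condition E).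
Implicit Types a b c d x : S.

(** If [c = a * e] then [e] fixes [c] on the right, so [star c <= e] and
    [a * star c = a * e * star c = c * star c = c]. *)
Lemma le_l_mul_star a c : le_l E c a -> (a * star E c = c)%g.
Proof.
case=> e Ee ca; have ce : (c * e = c)%g by rewrite ca -mulgA (E_idempotent hE).
have [_ /(_ e (conj Ee ce)) [_ es]] := starP hE c.
by rewrite -{1}es mulgA -ca mul_star.
Qed.

(** By the congruence condition [star (c * d) = star (plus d * d) = star d]. *)
Lemma factorization_unique {a b c d} : le_l E c a -> le_l E d b ->
    star E c = plus E d ->
  d = (b * star E (c * d))%g /\ c = (a * plus E (b * star E (c * d)))%g.
Proof.
move=> ca db cd.
have dE : d = (b * star E (c * d))%g.
  by rewrite (star_mul hE hC) cd mul_plus // le_l_mul_star.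
by rewrite -dE -cd le_l_mul_star.
Qed.

Lemma le_l_mul {a b c d} : le_l E c a -> le_l E d b -> star E c = plus E d ->
  le_l E (c * d)%g (a * b)%g.
Proof.
move=> ca db cd; exists (star E d); first exact: star_in.
by rewrite -mulgA (le_l_mul_star db) -{1}(le_l_mul_star ca) -mulgA cd mul_plus.
Qed.

(** The factor [b * star x] absorbs its own plus, so the product is
    [a * b * star x]. *)
Lemma mul_factorization a b x : le_l E x (a * b)%g ->
  (a * plus E (b * star E x) * (b * star E x) = x)%g.
Proof. by move=> xab; rewrite -mulgA mul_plus // mulgA le_l_mul_star. Qed.

(** The element [x = a * b * f] enters only through its star, and [a] enters only
    inside stars, as a left factor; so [a] may be exchanged with the idempotent
    [star a]. *)
Lemma generalized_right_ampleP : generalized_right_ample E <->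
  forall a b x, le_l E x (a * b)%g ->
    star E (a * plus E (b * star E x))%g = plus E (b * star E x)%g.
Proof.
split=> [hG a b _ [f Ef ->]|hP a e f Ee Ef /=]; last by apply: hP; exists f.
rewrite -mulgA (star_mul hE hC a (b * f)) (star_mul hE hC a (plus _ _)) mulgA.
by apply: hG => //; exact: star_in.
Qed.

End Factorization.

Section Linear.
Variables (k : comNzRingType) (K : choiceType).

Lemma linear_sum_seq (U V : lmodType k) (f : U -> V) (I : Type) (r : seq I)
    (F : I -> U) : linear f -> f (\sum_(i <- r) F i) = \sum_(i <- r) f (F i).
Proof.
move=> lf; elim/big_rec2: _ => [|i y x _ <-].
  by have := lf (-1) 0 0; rewrite scaler0 addr0 scaleN1r addNr.
by rewrite -[F i]scale1r lf !scale1r.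
Qed.

Lemma linear_fsum (U V : lmodType k) (f : U -> V) (A : set K) (F : K -> U) :
    finite_set A -> linear f ->
  f (\sum_(i \in A) F i) = \sum_(i \in A) f (F i).
Proof. by move=> fA lf; rewrite !fsbig_finite //= linear_sum_seq. Qed.

(** The regular module [k^o] makes coefficient extraction a linear map between
    modules, so that [linear_fsum] moves it through sums. *)
Lemma mcoeff_linear (x : K) :
  linear (fun g : {malg k[K]} => g@_x : (k^o : lmodType k)).
Proof. by move=> c u v; rewrite mcoeffD mcoeffZ. Qed.

End Linear.

Section Phi.
Variables (k : comNzRingType) (S : semigroupType) (E : set S).
Hypotheses (hE : reduced_EFountain E) (hC : congruence_condition E).
Hypothesis hfin : principally_finite (le_l E).
Implicit Types a b c d x : S.

Let phi := phi k hE hC.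
Let kS := semigroup_algebra k S.
Let kC := category_algebra k (associated_category hE hC).
Let basisS a : kS := << a >> : {malg k[S]}.
Let coefC (g : kC) x : k := (g : {malg k[assoc_mor S]})@_(C x).

Lemma coef_phi_basis a x : coefC (phi (basisS a)) x = `[< le_l E x a >]%:R.
Proof.
rewrite /coefC /phi /Defs.phi lin_ext_basis.
rewrite (linear_fsum (k := k) _ (hfin a) (mcoeff_linear (C x))).
have [xa|nxa] := asboolP (le_l E x a).
  rewrite -(fsbig_widen [set x]) => [||c [_ /= cx]].
  - by rewrite fsbig_set1 mcoeffUU.
  - by move=> _ ->.
  by rewrite mcoeffU; case: eqP => // -[/esym xc]; case: cx.
rewrite fsbig1 // => c /= ca; rewrite mcoeffU; case: eqP => // -[cx].
by case: nxa; rewrite -cx.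
Qed.

Lemma coef_table c d x :
  (category_table k (X := associated_category hE hC) (C c) (C d))@_(C x) =
  `[< star E c = plus E d /\ (c * d)%g = x >]%:R.
Proof.
have [cd|ncd] := pselect (star E c = plus E d).
  have Ccd := (assoc_composableP hE (C c) (C d)).2 cd.
  rewrite (category_tableE k (X := associated_category hE hC) Ccd) mcoeffU.
  congr (_%:R); congr nat_of_bool; apply/eqP/asboolP => [[]//|[_ <-]//].
rewrite category_table0 => [|/(assoc_composableP hE (C c) (C d)).1//].
by rewrite mcoeff0 asboolF // => -[].
Qed.

(** Only the pair of [factorization_unique] can contribute to the double sum. *)
Lemma coef_mul_phi_basis a b x :
  coefC (alg_mul (phi (basisS a)) (phi (basisS b))) x =
  `[< le_l E x (a * b)%g /\
      star E (a * plus E (b * star E x))%g = plus E (b * star E x)%g >]%:R.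
Proof.
set d0 := (b * star E x)%g; set c0 := (a * plus E d0)%g.
have d0b : le_l E d0 b by exists (star E x) => //; exact: star_in.
have c0a : le_l E c0 a by exists (plus E d0) => //; exact: plus_in.
pose T c d := (category_table k (X := associated_category hE hC)
  (C c) (C d))@_(C x).
have -> : coefC (alg_mul (phi (basisS a)) (phi (basisS b))) x =
    \sum_(c \in [set c | le_l E c a]) \sum_(d \in [set d | le_l E d b]) T c d.
  rewrite /coefC /phi /Defs.phi !lin_ext_basis /=.
  rewrite (linear_fsum _ (hfin a) (bilin_ext_linearl _ _)).
  rewrite (linear_fsum (k := k) _ (hfin a) (mcoeff_linear (C x))).
  apply: eq_fsbigr => c _.
  rewrite (linear_fsum _ (hfin b) (bilin_ext_linearr _ _)).
  rewrite (linear_fsum (k := k) _ (hfin b) (mcoeff_linear (C x))).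
  by apply: eq_fsbigr => d _; rewrite bilin_ext_basis.
have T0 c d : le_l E c a -> le_l E d b -> ~ (c = c0 /\ d = d0) -> T c d = 0.
  move=> ca db ncd; rewrite /T coef_table asboolF // => -[cd cdx].
  by apply: ncd; have [dE cE] := factorization_unique hE hC ca db cd; split;
     rewrite ?[LHS]cE ?[LHS]dE cdx.
rewrite -(fsbig_widen [set c0]) => [||c [/= ca cc0]]; first last.
- by rewrite fsbig1 // => d /= db; apply: T0 => // -[].
- by move=> _ ->.
rewrite fsbig_set1 -(fsbig_widen [set d0]) => [||d [/= db dd0]]; first last.
- by apply: T0 => // -[].
- by move=> _ ->.
rewrite fsbig_set1 /T coef_table; congr (_%:R); congr nat_of_bool.
apply/asboolP/asboolP => [[cd cdx]|[xab cd]]; split=> //.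
  by rewrite -cdx; exact: le_l_mul.
exact: mul_factorization.
Qed.

(** All coefficients are 0 or 1, which differ in [k]; so equality of coefficients
    says that the conditions governing them are equivalent. *)
Lemma phi_mul_basisP a b :
  phi (alg_mul (basisS a) (basisS b)) =
    alg_mul (phi (basisS a)) (phi (basisS b)) <->
  forall x, le_l E x (a * b)%g ->
    star E (a * plus E (b * star E x))%g = plus E (b * star E x)%g.
Proof.
have -> : alg_mul (basisS a) (basisS b) = basisS (a * b)%g.
  exact: bilin_ext_basis.
split=> [hab x xab|hab].
  have := congr1 (coefC^~ x) hab.
  rewrite coef_phi_basis coef_mul_phi_basis asboolT //.
  by case: asboolP => [[]//|_ /eqP]; rewrite oner_eq0.
apply/malgP => -[x]; rewrite -!/(coefC _ x) coef_phi_basis coef_mul_phi_basis.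
by congr (_%:R); congr nat_of_bool; apply/asboolP/asboolP => [xab|[]//];
   split=> //; exact: hab.
Qed.

Lemma algebra_hom_phiP : algebra_hom phi <->
  forall a b, phi (alg_mul (basisS a) (basisS b)) =
    alg_mul (phi (basisS a)) (phi (basisS b)).
Proof.
have lphi : linear phi by exact: lin_ext_linear.
split=> [[_ hm] a b|hm]; first exact: hm.
split=> // u v.
apply: (eq_linear_basis (M := kC) (f := fun u => phi (alg_mul (u : kS) v))
  (g := fun u => alg_mul (phi u) (phi v))) => {u} [||a].
- by move=> r s t; rewrite (alg_mul_linearl (a := kS)) lphi.
- by move=> r s t; rewrite lphi alg_mul_linearl.
apply: (eq_linear_basis (M := kC) (f := fun v => phi (alg_mul (basisS a) v))
  (g := fun v => alg_mul (phi (basisS a)) (phi v))) => {v} [||b].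
- by move=> r s t; rewrite (alg_mul_linearr (a := kS)) lphi.
- by move=> r s t; rewrite lphi alg_mul_linearr.
exact: hm.
Qed.

End Phi.

Theorem theorem4p2 (k : comNzRingType) (S : semigroupType) (E : set S)
    (hE : reduced_EFountain E) (hC : congruence_condition E)
    (hfin : principally_finite (le_l E)) :
  algebra_hom (phi k hE hC) <-> generalized_right_ample E.
Proof.
rewrite algebra_hom_phiP (generalized_right_ampleP hE hC).
by split=> h a b; apply/(phi_mul_basisP k hE hC hfin); exact: h.
Qed.
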